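(* Let $\mathcal{G}_b=(\mathcal{A}_b\cup\mathcal{B}_b,\mathcal{E}_b)$ be a weighted bipartite graph for which the number of agents and the number of tasks are both equal to $n$, i.e. $|\mathcal{A}_b|=|\mathcal{B}_b|=n$, where $n$ is also the cardinality of a maximum cardinality matching (MCM) of $\mathcal{G}_b$. Then the worst-case complexity of Algorithm 1 (described in the context) is $\mathcal{O}(n^3D)$, where $D$ is the diameter of the communication graph.
   Context: Setting: $\mathcal{G}_b=(\mathcal{V}_b,\mathcal{E}_b)$ is a finite undirected bipartite graph with $\mathcal{V}_b=\mathcal{A}_b\cup\mathcal{B}_b$ (agents $\mathcal{A}_b$, tasks $\mathcal{B}_b$), $\mathcal{A}_b\cap\mathcal{B}_b=\emptyset$, $\emptyset\neq\mathcal{E}_b\subseteq\{\{i,j\}\mid i\in\mathcal{A}_b,j\in\mathcal{B}_b\}$, weights $w:\mathcal{E}_b\to\mathbb{R}$. A matching is a set of edges no two of which share a vertex; an MCM is a matching of maximum cardinality. For a set of edges $\mathcal{E}$, $\mathcal{L}(\mathcal{E})=\arg\max_{e\in\mathcal{E}}w(e)$ (set of all maximisers). Paths: a path between $v_1$ and $v_{l+1}$ is a set of edges $\{\{v_k,v_{k+1}\}\mid k=1,\dots,l\}$ with $v_1,\dots,v_{l+1}$ distinct. It is alternating relative to a matching $\mathcal{N}$ if each vertex is incident to at most one edge of $\mathcal{P}\cap\mathcal{N}$ and at most one edge of $\mathcal{P}\setminus\mathcal{N}$, and augmenting relative to $\mathcal{N}$ if in addition both endpoints are incident to no edge of $\mathcal{N}$.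 Sublevel sets: for a graph $\mathcal{G}=(\mathcal{V},\mathcal{E})$ and a matching $\mathcal{M}$, $\psi(\mathcal{G},\mathcal{M})=\{e\in\mathcal{E}\mid w(e)\le\max_{e'\in\mathcal{M}}w(e')\}$ and $\psi_S(\mathcal{G},\mathcal{M})=\{e\in\mathcal{E}\mid w(e)<\max_{e'\in\mathcal{M}}w(e')\}$. Subroutine AugPath: for an MCM $\mathcal{M}$ of the current graph, $e\in\mathcal{M}$ and an edge set $\mathcal{E}$, $\mathrm{AugPath}(\mathcal{M}\setminus\{e\},\mathcal{E})$ returns an MCM $\mathcal{M}'\subseteq\mathcal{E}$ of the current graph if $\mathcal{E}$ contains an augmenting path relative to $\mathcal{M}\setminus\{e\}$, and returns $\mathcal{M}\setminus\{e\}$ otherwise. Algorithm 1. Input: $\mathcal{G}_b$ and an MCM $\mathcal{M}_0$. Initialise $\bar{\mathcal{V}}\gets\mathcal{V}_b$, $\bar{\mathcal{E}}\gets\mathcal{E}_b$, $\bar{\mathcal{M}}\gets\mathcal{M}_0$, $\mathcal{M}_b\gets\emptyset$, $\mathcal{U}\gets$ True. While $|\bar{\mathcal{M}}|>0$ repeat: (1) $\bar{\mathcal{G}}\gets(\bar{\mathcal{V}},\bar{\mathcal{E}})$; pick any $\bar e\in\mathcal{L}(\bar{\mathcal{M}})$; $\bar{\mathcal{E}}\gets\bar{\mathcal{M}}\cup\psi_S(\bar{\mathcal{G}},\bar{\mathcal{M}})$; $\mathcal{M}_\nu\gets\mathrm{AugPath}(\bar{\mathcal{M}}\setminus\{\bar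 e\},\bar{\mathcal{E}}\setminus\{\bar e\})$. (2) If an augmenting path was found (i.e. $\mathcal{M}_\nu\ne\bar{\mathcal{M}}\setminus\{\bar e\}$), set $\bar{\mathcal{M}}\gets\mathcal{M}_\nu$ and go to the next iteration. (3) Otherwise: $E'\gets\emptyset$; for each $e'\in\bar{\mathcal{M}}$ compute $\mathrm{AugPath}(\bar{\mathcal{M}}\setminus\{e'\},\psi(\bar{\mathcal{G}},\bar{\mathcal{M}})\setminus\{e'\})$ and, if no augmenting path was found (the call returns $\bar{\mathcal{M}}\setminus\{e'\}$), set $E'\gets E'\cup\{e'\}$. If $E'\cap\mathcal{L}(\bar{\mathcal{M}})=\emptyset$, set $\mathcal{U}\gets$ False and $E'\gets E'\cup\{\bar e\}$. Let $\mathcal{V}'$ be the set of vertices incident to an edge of $E'$; set $\bar{\mathcal{V}}\gets\bar{\mathcal{V}}\setminus\mathcal{V}'$, $\bar{\mathcal{E}}\gets\{\{i,j\}\in\bar{\mathcal{E}}\mid i,j\in\bar{\mathcal{V}}\}$, $\bar{\mathcal{M}}\gets\bar{\mathcal{M}}\setminus E'$, $\mathcal{M}_b\gets\mathcal{M}_b\cup E'$. Return $\mathcal{M}_b$ and the flag $\mathcal{U}$. Distributed setting and cost model: each agent $i\in\mathcal{A}_b$ has access to its incident edges in $\mathcal{E}_b$ and their weights. Agents communicate synchronously according to a global clock over a time-invariant, undirected, connected graph $\mathcal{G}_C=(\mathcal{A}_b,\mathcal{E}_C)$ of diameter $D$ (the maximum over pairs of vertices of the shortest path length), exchanging information with all neighbours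 at each time step. In this setting finding an edge of largest weight in the current matching (a distributed max-consensus) costs $\mathcal{O}(D)$ and each call of AugPath costs $\mathcal{O}(nD)$; the complexity of Algorithm 1 is the total cost of these operations over its run, in the worst case over inputs. *)

(* Defs.v *)
From mathcomp Require Import classical_sets reals constructive_ereal ereal.
(* After classical_sets, so that set0, cover and trivIset are those of finset. *)
From mathcomp Require Import all_boot all_order all_algebra.

Set Implicit Arguments.
Unset Strict Implicit.
Unset Printing Implicit Defensive.

Import Order.TTheory GRing.Theory Num.Theory.
Local Open Scope ring_scope.

(* Edges are two-element sets of vertices of an ambient finite type. *)

Record graph (V : finType) :=
  Graph { vertices : {set V}; edges : {set {set V}} }.

Section Graphs.
Variable V : finType.
Implicit Types (G : graph V) (M N P E : {set {set V}}) (u v x : V).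

Definition matching G M : Prop := M \subset edges G /\ trivIset M.

Definition MCM G M : Prop :=
  matching G M /\ forall M', matching G M' -> (#|M'| <= #|M|)%N.

(* The vertices are v :: s. A path has at least one edge: otherwise the empty
   set would be an augmenting path at every unmatched vertex. *)
Definition path_between u v P : Prop :=
  exists s : seq V,
    [/\ s != [::], uniq (u :: s), last u s = v
      & P = [set:: pairmap (fun x y => [set x; y]) u s]].

Definition alternating N P : Prop :=
  (exists u v, path_between u v P) /\
  forall x, (#|[set e in P :&: N | x \in e]| <= 1)%N /\
            (#|[set e in P :\: N | x \in e]| <= 1)%N.

Definition augmenting N P : Prop :=
  alternating N P /\
  exists u v, path_between u v P /\
    forall e, e \in N -> u \notin e /\ v \notin e.

(* AugPath is specified only through its result, so a call is a relation: M'
   is a possible value of AugPath(N, E) when the current graph is G. *)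
Definition AugPath G N E M' : Prop :=
  ((exists P, P \subset E /\ augmenting N P) -> MCM G M' /\ M' \subset E) /\
  (~ (exists P, P \subset E /\ augmenting N P) -> M' = N).

Definition adjacent (EC : {set {set V}}) : rel V :=
  fun x y => [set x; y] \in EC.

(* Length of a shortest walk from x to y; it is #|V| if y is not reachable. *)
Definition distance (EC : {set {set V}}) x y : nat :=
  find (fun k => [exists p : k.-tuple V,
                    path (adjacent EC) x p && (last x p == y)])
       (iota 0 #|V|).

Definition diameter (A : {set V}) (EC : {set {set V}}) : nat :=
  \max_(x in A) \max_(y in A) distance EC x y.

End Graphs.

Section Algorithm.
Variables (R : realType) (V : finType).
(* Only the weights of edges of the graph at hand are ever used. *)
Variable w : {set V} -> R.
Implicit Types (G : graph V) (M E : {set {set V}}).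

Definition argmax_weight E : {set {set V}} :=
  [set e in E | [forall e' in E, w e' <= w e]].

(* -oo if M is empty *)
Definition max_weight M : \bar R :=
  \big[Order.max/-oo%E]_(e in M) (w e)%:E.

Definition psi G M : {set {set V}} :=
  [set e in edges G | ((w e)%:E <= max_weight M)%E].

Definition psi_S G M : {set {set V}} :=
  [set e in edges G | ((w e)%:E < max_weight M)%E].

(* The variables Vbar, Ebar, Mbar, M_b and U at the head of the loop. *)
Record state := State {
  cur_graph : graph V;
  cur_matching : {set {set V}};
  output : {set {set V}};
  flag : bool
}.

Definition init_state (Gb : graph V) (M0 : {set {set V}}) : state :=
  State Gb M0 set0 true.

(* step tmax taug s c s': from s, one iteration of the loop may lead to s' at
   cost c, if finding an edge of largest weight costs at most tmax and a call
   of AugPath at most taug. Calls may have different costs. *)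
Inductive step (tmax taug : R) (s : state) : R -> state -> Prop :=
| step_augment (ebar : {set V}) (Mnu : {set {set V}}) (cmax caug : R) :
    let G := cur_graph s in
    let M := cur_matching s in
    let E := M :|: psi_S G M in
    (0 < #|M|)%N ->
    ebar \in argmax_weight M ->
    AugPath G (M :\ ebar) (E :\ ebar) Mnu ->
    Mnu != M :\ ebar ->
    0 <= cmax <= tmax -> 0 <= caug <= taug ->
    step tmax taug s (cmax + caug)
      (State (Graph (vertices G) E) Mnu (output s) (flag s))
| step_remove (ebar : {set V}) (Mnu : {set {set V}})
    (ret : {set V} -> {set {set V}}) (cmax caug : R) (cret : {set V} -> R) :
    let G := cur_graph s in
    let M := cur_matching s in
    let E := M :|: psi_S G M in
    let E0 := [set e' in M | ret e' == M :\ e'] in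
    let nonunique := E0 :&: argmax_weight M == set0 in
    let E' := if nonunique then ebar |: E0 else E0 in
    let V1 := vertices G :\: cover E' in
    (0 < #|M|)%N ->
    ebar \in argmax_weight M ->
    AugPath G (M :\ ebar) (E :\ ebar) Mnu ->
    Mnu = M :\ ebar ->
    (forall e', e' \in M -> AugPath G (M :\ e') (psi G M :\ e') (ret e')) ->
    0 <= cmax <= tmax -> 0 <= caug <= taug ->
    (forall e', e' \in M -> 0 <= cret e' <= taug) ->
    step tmax taug s (cmax + caug + \sum_(e' in M) cret e')
      (State (Graph V1 [set f in E | f \subset V1]) (M :\: E')
             (output s :|: E') (if nonunique then false else flag s)).

Inductive execution (tmax taug : R) (s : state) : R -> state -> Prop :=
| execution_start : execution tmax taug s 0 s
| execution_step c s1 c1 s2 :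
    execution tmax taug s c s1 -> step tmax taug s1 c1 s2 ->
    execution tmax taug s (c + c1) s2.

Definition nonterminating (tmax taug : R) (s : state) : Prop :=
  exists (run : nat -> state) (c : nat -> R),
    run 0 = s /\ forall t, step tmax taug (run t) (c t) (run t.+1).

End Algorithm.

Record instance (R : realType) := Instance {
  vtype : finType;
  agents : {set vtype};
  tasks : {set vtype};
  bip_edges : {set {set vtype}};
  weight : {set vtype} -> R;
  initial_matching : {set {set vtype}};
  comm_edges : {set {set vtype}}
}.
Arguments weight {R} i e.

Section Complexity.
Variable R : realType.

Definition bip_graph (I : instance R) : graph (vtype I) :=
  Graph (agents I :|: tasks I) (bip_edges I).

Definition bipartite_instance (I : instance R) : Prop :=
  [/\ [disjoint agents I & tasks I],
      bip_edges I != set0,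
      bip_edges I \subset [set [set i; j] | i in agents I, j in tasks I]
    & MCM (bip_graph I) (initial_matching I)].

Definition connected_comm_graph (I : instance R) : Prop :=
  comm_edges I \subset
    [set [set i; j] | i in agents I, j in agents I & i != j] /\
  forall i j, i \in agents I -> j \in agents I ->
    connect (adjacent (comm_edges I)) i j.

Definition instance_of_size (n D : nat) (I : instance R) : Prop :=
  [/\ bipartite_instance I, connected_comm_graph I,
      #|agents I| = n /\ #|tasks I| = n, #|initial_matching I| = n
    & diameter (agents I) (comm_edges I) = D].

(* Supremum, over all inputs of size n with communication diameter D and all
   choices made by the algorithm, of the cost incurred. As costs are
   nonnegative, also counting the cost so far of unfinished executions does not
   change the supremum; an infinite run counts as +oo, whatever its steps
   cost. *)
Definition worst_case_complexity (tmax taug : nat -> nat -> R) (n D : nat)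
    : \bar R :=
  ereal_sup [set x | exists I : instance R,
    instance_of_size n D I /\
    let s0 := init_state (bip_graph I) (initial_matching I) in
    ((exists c s, execution (weight I) (tmax n D) (taug n D) s0 c s /\
                  x = c%:E) \/
     (nonterminating (weight I) (tmax n D) (taug n D) s0 /\ x = +oo%E))]%classic.

(* f = O(g) uniformly in n >= 1 and D >= 0, for costs f; only upper bounds are
   needed, and the supremum of no cost at all is -oo. *)
Definition bigO (f : nat -> nat -> \bar R) (g : nat -> nat -> nat) : Prop :=
  exists K : R, forall n D : nat, (0 < n)%N ->
    (f n D <= (K * (g n D)%:R)%:E)%E.

End Complexity.

(* Main.v *)
Require Import Defs.
From mathcomp Require Import classical_sets reals constructive_ereal ereal.
From mathcomp Require Import all_boot all_order all_algebra.
From mathcomp Require Import boolp ring lra.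

(* Potential argument. An augmenting iteration loses the edge [ebar] for good:
   its weight bounds every weight in the new matching, which avoids it, so the
   next strict sublevel set avoids it too. Hence there are at most n^2 such
   iterations, each with one call of AugPath. A removing iteration deletes at
   least one vertex, so there are at most 2n of them, each with at most 2n + 1
   calls. *)

Set Implicit Arguments.
Unset Strict Implicit.
Unset Printing Implicit Defensive.

Import Order.TTheory GRing.Theory Num.Theory.
Local Open Scope ring_scope.

Lemma card_trivIset_leq_cover (T : finType) (P : {set {set T}}) :
  set0 \notin P -> trivIset P -> (#|P| <= #|cover P|)%N.
Proof.
move=> P0 /eqP <-; rewrite -sum1_card; apply: leq_sum => e eP.
by rewrite card_gt0; apply: contraNneq P0 => <-.
Qed.

Lemma subset_setD_cover (T : finType) (P Q : {set {set T}}) (f : {set T}) :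
  trivIset P -> Q \subset P -> f \in P :\: Q -> [disjoint f & cover Q].
Proof.
move=> /trivIsetP tP QP /setDP[fP fQ].
apply/bigcup_disjointP => e eQ; apply: tP => //; first exact: (subsetP QP).
by apply: contraNneq fQ => ->.
Qed.

Lemma card_imset2_leq (aT bT rT : finType) (f : aT -> bT -> rT)
    (A : {set aT}) (B : {set bT}) :
  (#|[set f x y | x in A, y in B]| <= #|A| * #|B|)%N.
Proof. by rewrite curry_imset2X -cardsX leq_imset_card. Qed.

Section Descent.
Variables (R : realType) (V : finType) (w : {set V} -> R).
Implicit Types (G : graph V) (M N E : {set {set V}}) (s : state V).

Lemma max_weight_le M (x : R) :
  (forall e, e \in M -> w e <= x) -> (max_weight w M <= x%:E)%E.
Proof.
move=> Mx; rewrite /max_weight.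
elim/big_ind: _ => [|a b|e /Mx]; rewrite ?leNye ?lee_fin //.
by rewrite ge_max => -> ->.
Qed.

Lemma argmax_weight_sub M : argmax_weight w M \subset M.
Proof. by apply/subsetP => e; rewrite inE => /andP[]. Qed.

Lemma argmax_weight_max M e :
  e \in argmax_weight w M -> (max_weight w M <= (w e)%:E)%E.
Proof.
by rewrite inE => /andP[_ /forall_inP eM]; apply: max_weight_le.
Qed.

Lemma psi_S_sub G M : psi_S w G M \subset edges G.
Proof. by apply/subsetP => e; rewrite inE => /andP[]. Qed.

(** The algorithm only inspects the returned value; contraposing the second clause of [AugPath]
    turns that test into the existence of an augmenting path. *)
Lemma AugPath_found G N E M' :
  AugPath G N E M' -> M' != N -> MCM G M' /\ M' \subset E.
Proof.
by move=> [found notfound] /eqP M'N; apply: found; apply: contra_notP M'N.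
Qed.

(** The loop invariant. Nonempty edges make disjoint edges occupy distinct vertices, so [n] also
    bounds the size of the matching. *)
Record valid (n : nat) s : Prop := Valid {
  valid_matching : matching (cur_graph s) (cur_matching s);
  valid_neq0 : set0 \notin edges (cur_graph s);
  valid_sub : forall e, e \in edges (cur_graph s) ->
    e \subset vertices (cur_graph s);
  valid_card : (#|vertices (cur_graph s)| <= n)%N }.

(** The edge set that the coming iteration computes. After an augmentation the current graph still
    contains [ebar]; only this set has already lost it, so it is the one to count. *)
Definition active s : {set {set V}} :=
  cur_matching s :|: psi_S w (cur_graph s) (cur_matching s).

Lemma active_sub n s : valid n s -> active s \subset edges (cur_graph s).
Proof. by case=> [[sM _] _ _ _]; rewrite subUset sM psi_S_sub. Qed.

Lemma valid_card_matching n s : valid n s -> (#|cur_matching s| <= n)%N.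
Proof.
case=> [[sM tM] n0 sV cV]; apply: leq_trans cV.
apply: leq_trans (card_trivIset_leq_cover _ tM) _.
  by apply: contra n0; apply: (subsetP sM).
by apply/subset_leq_card/bigcupsP => e /(subsetP sM)/sV.
Qed.

Lemma augment_descent n s ebar Mnu :
  let G := cur_graph s in let M := cur_matching s in let E := active s in
  let s' := State (Graph (vertices G) E) Mnu (output s) (flag s) in
  valid n s -> ebar \in argmax_weight w M ->
  AugPath G (M :\ ebar) (E :\ ebar) Mnu -> Mnu != M :\ ebar ->
  valid n s' /\ (#|active s'| < #|active s|)%N.
Proof.
move=> G M E s' vs eM aug found.
have [[[_ tMnu] _] sMnu] := AugPath_found aug found.
have sE : E \subset edges G by apply: active_sub vs.
have sMnuE : Mnu \subset E by apply: subset_trans sMnu (subD1set _ _).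
have eE : ebar \in E.
  by rewrite inE (subsetP (argmax_weight_sub _) _ eM).
split.
  case: vs => [_ n0 sV cV]; split=> //=.
    by apply: contra n0; apply: (subsetP sE).
  by move=> e /(subsetP sE)/sV.
(* An edge of [Mnu] lies in [M], where [ebar] is heaviest, or strictly below the maximal weight of
   [M]. *)
have Mnu_le : (max_weight w Mnu <= (w ebar)%:E)%E.
  apply: max_weight_le => e /(subsetP sMnuE); rewrite /E /active !inE.
  case/orP => [eM'|/andP[_ /ltW ew]].
    by move: eM; rewrite inE => /andP[_ /forall_inP]; apply.
  by rewrite -lee_fin (le_trans ew) ?argmax_weight_max.
have act : active s' \subset E :\ ebar.
  rewrite subUset sMnu /=; apply/subsetP => e; rewrite !inE /= => /andP[-> ew].
  rewrite andbT; apply: contraTneq ew => ->.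
  by rewrite -leNgt.
by rewrite [X in (_ < X)%N](cardsD1 ebar) eE ltnS subset_leq_card.
Qed.

(** Edges of [M] outside [E'] are disjoint from those in [E'], so they survive the deletion of
    [cover E']; any edge of [E'] supplies a deleted vertex. *)
Lemma remove_descent n s E' out b :
  let G := cur_graph s in let M := cur_matching s in let E := active s in
  let V1 := vertices G :\: cover E' in
  let s' := State (Graph V1 [set f in E | f \subset V1]) (M :\: E') out b in
  valid n s -> E' \subset M -> E' != set0 ->
  [/\ valid n s', (#|active s'| <= #|active s|)%N
    & (#|vertices (cur_graph s')| < #|vertices (cur_graph s)|)%N].
Proof.
move=> G M E V1 s' vs sE'M /set0Pn[e eE'].
have sE : E \subset edges G by apply: active_sub vs.
have [[sM tM] n0 sV cV] := vs.
have vs' : valid n s'.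
  split=> /=.
  - split; last by apply: trivIsetS tM; apply: subsetDl.
    apply/subsetP => f fME'; have /setDP[fM _] := fME'.
    rewrite /= !inE fM /= subsetD (sV _ (subsetP sM _ fM)) /=.
    exact: subset_setD_cover fME'.
  - by apply: contra n0; rewrite inE => /andP[/(subsetP sE)].
  - by move=> f; rewrite inE => /andP[].
  - by apply: leq_trans cV; rewrite subset_leq_card ?subsetDl.
split=> //.
  apply: subset_leq_card; apply: subset_trans (active_sub vs') _.
  by apply/subsetP => f /=; rewrite inE => /andP[].
have eG : e \in edges G by rewrite (subsetP sM) ?(subsetP sE'M).
have /set0Pn[x xe] : e != set0 by apply: contraNneq n0 => <-.
apply: proper_card; apply/properP; split; first exact: subsetDl.
exists x; first exact: (subsetP (sV _ eG)).
by rewrite inE negb_and negbK; apply/orP; left; apply/bigcupP; exists e.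
Qed.

Variables (n : nat) (tmax taug T A : R).

(** Each active edge prepays one augmenting iteration, and each vertex one removing iteration with
    [n.+1] calls of AugPath. *)
Definition potential s : R :=
  #|active s|%:R * (T + A) +
  #|vertices (cur_graph s)|%:R * (T + n.+1%:R * A).

(** The integer measure serves termination: a step may cost nothing, so the bound on the potential
    alone does not exclude an infinite run. *)
Lemma step_descent s c s' :
  tmax <= T -> taug <= A -> valid n s -> step w tmax taug s c s' ->
  [/\ valid n s', c + potential s' <= potential s
    & (#|active s'| + #|vertices (cur_graph s')| <
       #|active s| + #|vertices (cur_graph s)|)%N].
Proof.
move=> tmaxT taugA vs.
case=> {c s'} [ebar Mnu cmax caug G M E _ eM aug found|
  ebar Mnu ret cmax caug cret G M E E0 nonunique E' V1 _ eM _ _ _].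
  move=> /andP[cmax0 cmaxt] /andP[caug0 caugt].
  have [vs' lt] := augment_descent vs eM aug found.
  set s' := State _ _ _ _ in vs' lt *.
  split=> //; last by rewrite ltn_add2r.
  rewrite /potential addrA lerD2r.
  apply: (@le_trans _ _ (#|active s'|.+1%:R * (T + A))).
    by rewrite mulrSr mulrDl mul1r addrC lerD2l; lra.
  by apply: ler_wpM2r; [lra | rewrite ler_nat].
move=> /andP[cmax0 cmaxt] /andP[caug0 caugt] crett.
have sE0M : E0 \subset M by apply/subsetP => f; rewrite inE => /andP[].
have eM' : ebar \in M by apply: subsetP eM; apply: argmax_weight_sub.
have sE'M : E' \subset M.
  by rewrite /E'; case: ifP => _ //; rewrite subUset sub1set eM'.
(* Either [ebar] has just been added, or [E0] meets the set of heaviest edges. *)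
have E'0 : E' != set0.
  rewrite /E'; case: ifPn => [_|].
    by apply/set0Pn; exists ebar; rewrite setU11.
  by apply: contraNneq => E00; rewrite /nonunique E00 set0I.
have [vs' le lt] := remove_descent (output s :|: E')
  (if nonunique then false else flag s) vs sE'M E'0.
set s' := State _ _ _ _ in vs' le lt *.
have A0 : 0 <= A by lra.
split=> //; last by rewrite -addnS leq_add.
have sum_le : \sum_(e' in M) cret e' <= n%:R * A.
  apply: (@le_trans _ _ (\sum_(e' in M) A)).
    by apply: ler_sum => e' /crett/andP[_ /le_trans]; apply.
  rewrite sumr_const -[A *+ _]mulr_natl.
  by apply: ler_wpM2r; rewrite ?ler_nat ?(valid_card_matching vs).
have nA0 : 0 <= n%:R * A by rewrite mulr_ge0.
have SnA : n.+1%:R * A = n%:R * A + A by rewrite mulrSr mulrDl mul1r.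
rewrite /potential SnA.
have act_le : #|active s'|%:R * (T + A) <= #|active s|%:R * (T + A).
  by apply: ler_wpM2r; [lra | rewrite ler_nat].
have : #|vertices (cur_graph s')|.+1%:R * (T + (n%:R * A + A)) <=
       #|vertices (cur_graph s)|%:R * (T + (n%:R * A + A)).
  by apply: ler_wpM2r; [lra | rewrite ler_nat].
by rewrite mulrSr mulrDl mul1r; lra.
Qed.

Lemma execution_descent s c s' :
  tmax <= T -> taug <= A -> valid n s -> execution w tmax taug s c s' ->
  valid n s' /\ c + potential s' <= potential s.
Proof.
move=> tmaxT taugA vs.
elim=> [|{}c s1 c1 s2 _ [vs1 le1] /(step_descent tmaxT taugA vs1)[vs2 le2 _]].
  by rewrite add0r.
by split=> //; apply: le_trans le1; rewrite -addrA lerD2l.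
Qed.

Lemma valid_terminating s :
  tmax <= T -> taug <= A -> valid n s -> ~ nonterminating w tmax taug s.
Proof.
move=> tmaxT taugA vs [run [c [run0 stepr]]].
pose size_ s := (#|active s| + #|vertices (cur_graph s)|)%N.
have desc t : valid n (run t) /\ (size_ (run t) + t <= size_ s)%N.
  elim: t => [|t [vt le]]; first by rewrite run0 addn0.
  have [vt' _ lt] := step_descent tmaxT taugA vt (stepr t).
  by split=> //; apply: leq_trans le; rewrite addnS -addSn leq_add2r.
(* One step more than the initial measure allows. *)
have [_] := desc (size_ s).+1.
by rewrite addnS ltnNge leq_addl.
Qed.

Lemma potential_ge0 s : 0 <= T -> 0 <= A -> 0 <= potential s.
Proof. by move=> T0 A0; rewrite addr_ge0 ?mulr_ge0 ?addr_ge0 ?mulr_ge0. Qed.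

End Descent.

Lemma init_valid (R : realType) (n D : nat) (I : instance R) :
  let s0 := init_state (bip_graph I) (initial_matching I) in
  instance_of_size n D I ->
  valid n.*2 s0 /\ (#|active (weight I) s0| <= n ^ 2)%N.
Proof.
move=> s0 [[dAB _ sE [mM0 _]] _ [cA cB] _ _].
have vs : valid n.*2 s0.
  split=> //=.
  - apply: contraL (isT : true) => /(subsetP sE)/imset2P[i j _ _ e0].
    by have := set21 i j; rewrite -e0 inE.
  - move=> e /(subsetP sE)/imset2P[i j iA jB ->].
    by rewrite subUset !sub1set !inE iA jB orbT.
  - by rewrite cardsU cA cB addnn leq_subr.
split=> //; apply: leq_trans (subset_leq_card (active_sub _ vs)) _.
apply: leq_trans (subset_leq_card sE) _.
by apply: leq_trans (card_imset2_leq _ _ _) _; rewrite cA cB mulnn.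
Qed.

(** The constant in [bigO] may be negative, whereas the potential argument needs nonnegative cost
    bounds [T] and [A]. *)
Lemma bigO_nonneg (R : realType) (f : nat -> nat -> \bar R) g :
  bigO f g -> exists2 K : R, 0 <= K &
    forall n D : nat, (0 < n)%N -> (f n D <= (K * (g n D)%:R)%:E)%E.
Proof.
move=> [K fK]; exists `|K| => // n D n0; apply: le_trans (fK n D n0) _.
by rewrite lee_fin ler_wpM2r ?ler_norm.
Qed.

Theorem proposition6 (R : realType) (tmax taug : nat -> nat -> R)
    (tmax_bigO : bigO (fun n D => (tmax n D)%:E%E) (fun n D => D))
    (taug_bigO : bigO (fun n D => (taug n D)%:E%E) (fun n D => (n * D)%N)) :
  bigO (worst_case_complexity tmax taug) (fun n D => (n ^ 3 * D)%N).
Proof.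
have [K1 K10 tmaxK] := bigO_nonneg tmax_bigO.
have [K2 K20 taugK] := bigO_nonneg taug_bigO.
(* With [T = K1 * D] and [A = K2 * (n * D)], the initial potential is at most [K1 * D * (n^2 + 2n) +
   K2 * D * (5n^3 + 2n^2)]; for [n >= 1] the brackets are at most [3n^3] and [7n^3]. *)
exists (3 * K1 + 7 * K2) => n D n0.
have {tmaxK}tmaxT := tmaxK n D n0; rewrite lee_fin in tmaxT.
have {taugK}taugA := taugK n D n0; rewrite lee_fin in taugA.
set T := K1 * _ in tmaxT; set A := K2 * _ in taugA.
have T0 : 0 <= T by rewrite mulr_ge0.
have A0 : 0 <= A by rewrite mulr_ge0.
apply: ge_ereal_sup => x [I [/init_valid[vs act]]] /=.
set s0 := init_state _ _ in vs act *.
case=> [[c [s [ex ->]]]|[/(valid_terminating tmaxT taugA vs) //]].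
have [_ cost] := execution_descent tmaxT taugA vs ex.
(* The final potential is nonnegative, so the initial one bounds the cost. *)
rewrite lee_fin; apply: (@le_trans _ _ (potential (weight I) n.*2 T A s0)).
  by apply: le_trans cost; rewrite lerDl potential_ge0.
apply: (@le_trans _ _ ((n ^ 2)%:R * (T + A) + n.*2%:R * (T + n.*2.+1%:R * A))).
  apply: lerD; apply: ler_wpM2r; rewrite ?ler_nat ?addr_ge0 ?mulr_ge0 //.
  exact: valid_card vs.
rewrite /T /A -muln2 -[(n * 2).+1]addn1 (natrD _ (n * 2)) (natrM _ (n ^ 3)).
rewrite !natrX (natrM _ n 2) (natrM _ n D).
have n1 : 1 <= n%:R :> R by rewrite ler1n.
have D0 : 0 <= D%:R :> R by [].
set m : R := n%:R in n1 *; set d : R := D%:R in D0 *.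
rewrite -subr_ge0.
(* Factoring out [m - 1] makes every factor visibly nonnegative when [m >= 1]. *)
have -> : (3 * K1 + 7 * K2) * (m ^+ 3 * d) -
    (m ^+ 2 * (K1 * d + K2 * (m * d)) +
     m * 2 * (K1 * d + (m * 2 + 1) * (K2 * (m * d)))) =
    K1 * d * (m * (m - 1) * (3 * m + 2)) +
    K2 * d * (2 * m ^+ 2 * (m - 1)) by ring.
have m0 : 0 <= m by lra.
have m1 : 0 <= m - 1 by lra.
have m2 : 0 <= 3 * m + 2 by lra.
by apply: addr_ge0; rewrite !mulr_ge0 ?exprn_ge0.
Qed.
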